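(* Let $n\ge 3$, let $T$ be a tree on the vertex set $[n]$ and let $c$ be a centroid of $T$. Then \[ \Phi_c(T)\leq \left\lfloor\frac{n^2}{4}\right\rfloor-n+1 . \] Equality holds if and only if $T$ is a path tree.
   Context: For a tree $T$ on $[n]=\{1,\dots,n\}$ and $c\in[n]$, $\Phi_c(T)=\sum_{x\in V(T)\setminus\{c\}}(d_T(x,c)-1)$, where $d_T$ is the distance in $T$. A vertex $c$ of a tree $T$ with $n$ vertices is a centroid if all connected components of $T\setminus\{c\}$ have at most $n/2$ vertices. A path tree is a tree consisting of a path. *)

(* Defs.v *)
From mathcomp Require Import all_boot all_order all_algebra.
Import GRing.Theory Num.Theory.

Set Implicit Arguments.
Unset Strict Implicit.
Unset Printing Implicit Defensive.

Section Trees.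
Variable V : finType.
Implicit Types (T : rel V) (c x y : V).

(* A finite simple graph is given by its adjacency relation. *)
Record is_tree T : Prop := IsTree {
  tree_sym : symmetric T;
  tree_irr : irreflexive T;
  tree_conn : forall x y, connect T x y;
  (* [ucycle] also accepts the empty cycle and x - y - x, hence the bound 2. *)
  tree_acyclic : forall p : seq V, ucycle T p -> size p <= 2
}.

Definition walk T x y (k : nat) : bool :=
  [exists p : k.-tuple V, path T x p && (last x p == y)].

(* Least length of a walk from x to y; a shortest walk has fewer than #|V|
   steps, and the value #|V| is taken only if x and y are not connected. *)
Definition dist T x y : nat := find (walk T x y) (iota 0 #|V|).

Definition del_vertex T c : rel V := [rel x y | [&& T x y, x != c & y != c]].

(* The vertex sets of the connected components of T minus the vertex c. *)
Definition components_without T c : {set {set V}} :=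
  equivalence_partition (connect (del_vertex T c)) [set~ c].

(* The bound #|C| <= #|V| / 2, without the rounding of integer division. *)
Definition is_centroid T c : Prop :=
  forall C : {set V}, C \in components_without T c -> 2 * #|C| <= #|V|.

Definition Phi T c : int := (\sum_(x | x != c) ((dist T x c)%:Z - 1))%R.

Definition is_path_tree T : Prop :=
  exists2 f : 'I_#|V| -> V, bijective f &
    forall i j, T (f i) (f j) = (i.+1 == j :> nat) || (j.+1 == i :> nat).

End Trees.

(* Main.v *)
Require Import Defs.
From mathcomp Require Import all_boot all_order all_algebra.
From mathcomp Require Import zify.

Set Implicit Arguments.
Unset Strict Implicit.
Unset Printing Implicit Defensive.

(** Call dist T x c the depth of x and let D be the sum of all depths, so that
    Phi T c = D - (n - 1) and the claim is D <= n^2 / 4 (rounded down) with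
    equality exactly for paths.  Counting by layers, D is the sum over j of the
    number of vertices of depth > j.

    Upper bound.  If some vertex v has depth > j, then at least 2j + 1 vertices
    have depth <= j (low_card): the vertex c; the first j vertices on the
    geodesic from c to v, all in the branch of v at c; and j more outside that
    branch, because either another branch also reaches depth > j, or everything
    outside the branch of v is low, and there is enough of it since the branch
    of v holds at most half of all vertices.  Hence layer j contributes at most
    n - 1 - 2j, truncated at 0, and these numbers add up to n^2 / 4.

    Equality.  Then every layer bound is attained.  The layer counts produce a
    vertex v of depth n/2, whose geodesic fills its branch, and a vertex w in
    another branch of depth n - 1 - n/2.  The two geodesics meet only in c and
    together visit every vertex (sum_depth_max_spanning_path); in an acyclic
    graph a path through all vertices has no chord, so the tree is that path.

    Conversely, number the vertices of a path 0, ..., n - 1.  A walk changes the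
    number by at most 1 per step, so depths are at least |i - k| where k is the
    number of c, and the sum of |i - k| over i is at least n^2 / 4 for every k
    (path_tree_sum_dist_ge).  Together with the upper bound this is equality. *)

(** * The extremal sum *)

(** The truncated sum (n-1) + (n-3) + ...; removing its first term replaces n by
    n - 2, and n^2 / 4 drops by the same n - 1. *)
Lemma sum_truncated_odd n N : n <= N.*2 ->
  \sum_(j < N) (n.-1 - j.*2) = n ^ 2 %/ 4.
Proof.
elim: N n => [|N IH] [|[|n]] // le.
- by rewrite big_ord0.
- by rewrite big1.
- by rewrite big1.
rewrite big_ord_recl /=.
under eq_bigr => j _ do rewrite /bump leq0n /=.
have -> : \sum_(j < N) (n.+1 - (1 + j).*2) = n ^ 2 %/ 4.
  by rewrite -IH; [apply: eq_bigr => j _; lia | lia].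
have -> : n.+2 ^ 2 = n.+1 * 4 + n ^ 2 by lia.
by rewrite divnMDl //; lia.
Qed.

(** * Distances in a connected graph *)

Section Distance.
Variables (V : finType) (T : rel V).
Implicit Types (c x y z : V) (p : seq V).

Lemma walkP x y k :
  reflect (exists p, [/\ path T x p, last x p = y & size p = k]) (walk T x y k).
Proof.
apply: (iffP existsP) => [[p /andP[Tp /eqP lp]]|[p [Tp lp sp]]].
  by exists p; split; rewrite ?size_tuple.
by exists (tcast sp (in_tuple p)); rewrite val_tcast Tp lp eqxx.
Qed.

Lemma dist_le_card x y : dist T x y <= #|V|.
Proof. by rewrite -[#|V|](size_iota 0) find_size. Qed.

(** A walk with #|V| or more steps lies outside the range searched by dist,
    but dist never exceeds #|V|. *)
Lemma dist_le_size x p : path T x p -> dist T x (last x p) <= size p.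
Proof.
move=> Tp; have wp : walk T x (last x p) (size p) by apply/walkP; exists p.
case: (ltnP (size p) #|V|) => [ltp|]; last exact: leq_trans (dist_le_card _ _).
rewrite leqNgt; apply/negP => /(before_find 0).
by rewrite nth_iota // add0n wp.
Qed.

Lemma dist0 x : dist T x x = 0.
Proof. by apply/eqP; rewrite -leqn0 (@dist_le_size x [::]). Qed.

Hypothesis connT : forall x y, connect T x y.

(** Shortening a walk to one without repeated vertices brings its length below
    #|V|, so the search in dist succeeds. *)
Lemma dist_attained x y :
  exists p, [/\ path T x p, last x p = y & size p = dist T x y].
Proof.
apply/walkP; have /connectP[p Tp ->] := connT x y.
case/shortenP: Tp => q Tq uq _.
have ltq : size q < #|V|.
  by rewrite -[(size q).+1]/(size (x :: q)) -(card_uniqP uq) max_card.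
have wq : has (walk T x (last x q)) (iota 0 #|V|).
  by apply/hasP; exists (size q); [rewrite mem_iota | apply/walkP; exists q].
have := nth_find 0 wq; rewrite nth_iota //.
by rewrite -[X in _ < X](size_iota 0) -has_find.
Qed.

Lemma dist_eq0 x y : (dist T x y == 0) = (x == y).
Proof.
apply/eqP/eqP => [d0|->]; last exact: dist0.
by have [[|z p] [_ /= lp]] := dist_attained x y; rewrite d0.
Qed.

(** The second vertex of a shortest walk; this drives induction on depth. *)
Lemma dist_closer_neighbour x y k :
  dist T x y = k.+1 -> exists2 z, T x z & dist T z y = k.
Proof.
move=> dxy; have [[|z p] /= [Txp lp sp]] := dist_attained x y.
  by rewrite dxy in sp.
move: Txp sp => /andP[Txz Tzp]; rewrite dxy => -[sp].
exists z => //; apply/eqP; rewrite eqn_leq -{1}sp -{1}lp dist_le_size //=.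
have [q [Tq lq sq]] := dist_attained z y.
rewrite -ltnS -dxy -sq -lq; apply: (@dist_le_size x (z :: q)).
by rewrite /= Txz.
Qed.

End Distance.

(** * Branches at a vertex and the geodesics inside them *)

Section Branch.
Variables (V : finType) (T : rel V) (c : V).
Hypotheses (symT : symmetric T) (connT : forall x y, connect T x y).
Implicit Types (x y v w : V).

Local Notation depth x := (dist T x c).

(** The component of v in the graph without c, as a set indexed by v rather
    than as a block of the partition; it is empty for v = c. *)
Definition branch v : {set V} :=
  [set y in [set~ c] | connect (del_vertex T c) v y].

Lemma del_vertex_connect_sym : connect_sym (del_vertex T c).
Proof.
by apply: sym_connect_sym => x y; rewrite /del_vertex /= symT [(y != c) && _]andbC.
Qed.

Lemma branch_refl v : v != c -> v \in branch v.
Proof. by move=> vc; rewrite !inE vc connect0. Qed.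

Lemma branch_center v : c \notin branch v.
Proof. by rewrite !inE eqxx. Qed.

Lemma branch_disjoint v w : w != c -> w \notin branch v ->
  [disjoint branch w & branch v].
Proof.
move=> wc; rewrite !inE wc /= => Nvw.
apply/pred0P => y /=; rewrite !inE; apply/negP.
case/andP=> /andP[_ wy] /andP[_ vy]; case/negP: Nvw.
by apply: connect_trans vy _; rewrite del_vertex_connect_sym.
Qed.

Lemma centroid_branch v : is_centroid T c -> v != c -> 2 * #|branch v| <= #|V|.
Proof.
move=> ctr vc; apply: ctr; apply/imsetP; exists v; first by rewrite !inE.
by [].
Qed.

(** A shortest path from c, listed without c itself.  Its depths increase by one
    at each step, so after leaving c it never returns and stays in one branch. *)
Lemma geodesic_in_branch v : exists s,
  [/\ path T c s, last c s = v, map (dist T ^~ c) s = iota 1 (depth v)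
    & {subset s <= branch v}].
Proof.
move dv: (depth v) => k; elim: k => [|k IH] in v dv *.
  by move/eqP: dv; rewrite dist_eq0 // => /eqP->; exists [::].
have [u Tvu du] := dist_closer_neighbour connT dv.
have vc : v != c by rewrite -(dist_eq0 connT) dv.
have [s [Ts ls ds sub]] := IH u du.
exists (rcons s v); split.
- by rewrite rcons_path Ts ls symT.
- by rewrite last_rcons.
- by rewrite map_rcons ds dv -cats1 -[in RHS](addn1 k) iotaD.
move=> y; rewrite mem_rcons inE => /predU1P[->|ys]; first exact: branch_refl.
have : y \in branch u by exact: sub.
case: (posnP k) => [k0|k0]; first by move: ds ys; rewrite k0; case: (s).
have uc : u != c by rewrite -(dist_eq0 connT) du -lt0n.
rewrite !inE => /andP[-> uy] /=.
by apply: (connect_trans _ uy); apply: connect1; rewrite /del_vertex /= Tvu vc uc.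
Qed.

(** Distinct depths force distinct vertices. *)
Lemma geodesic_uniq v s :
  map (dist T ^~ c) s = iota 1 (depth v) -> uniq (c :: s).
Proof.
move=> ds; have : uniq (map (dist T ^~ c) (c :: s)).
  by rewrite /= ds dist0 iota_uniq mem_iota.
exact: map_uniq.
Qed.

Lemma branch_low_card v j :
  j < depth v -> j <= #|[set y in branch v | depth y <= j]|.
Proof.
have [s [_ _ ds sub]] := geodesic_in_branch v => ltj.
have /= /andP[_ us] := geodesic_uniq ds.
have ss : size s = depth v by rewrite -(size_map (dist T ^~ c)) ds size_iota.
have sj : size (take j s) = j by rewrite size_takel // ss ltnW.
rewrite -{1}sj -(card_uniqP (take_uniq j us)).
apply/subset_leq_card/subsetP => y ys.
rewrite inE sub ?(mem_take ys) //=.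
have : depth y \in iota 1 j.
  have -> : iota 1 j = take j (map (dist T ^~ c) s).
    by rewrite ds take_iota; congr iota; lia.
  by rewrite -map_take; apply: map_f.
by rewrite mem_iota add1n ltnS => /andP[].
Qed.

Lemma branch_card_ge v : depth v <= #|branch v|.
Proof.
have [s [_ _ ds sub]] := geodesic_in_branch v.
have /= /andP[_ us] := geodesic_uniq ds.
have <- : size s = depth v by rewrite -(size_map (dist T ^~ c)) ds size_iota.
by rewrite -(card_uniqP us); apply/subset_leq_card/subsetP.
Qed.

(** * Layers of depth around a centroid *)

Hypothesis ctr : is_centroid T c.

(** The vertex c and j vertices inside the branch of v are low; the remaining j
    come from outside that branch. *)
Lemma low_card v j : j < depth v -> j.*2 < #|[set y | depth y <= j]|.
Proof.
move=> ltj; have vc : v != c by rewrite -(dist_eq0 connT); lia.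
set L := [set y | _].
have lowE (B : {set V}) : [set y in B | depth y <= j] = B :&: L.
  by apply/setP=> y; rewrite !inE.
have in1 : j <= #|branch v :&: L| by rewrite -lowE branch_low_card.
have cL : c \in L by rewrite inE dist0.
suff out1 : j < #|L :\: branch v|.
  by rewrite -(cardsID (branch v) L) setIC; lia.
case: (pickP [pred w | (w \notin branch v) && (j < depth w)]) => [w|low].
  (* A second branch reaches depth > j and supplies its own j low vertices. *)
  move=> /andP[/= wv ltw]; have wc : w != c by rewrite -(dist_eq0 connT); lia.
  have dvw := branch_disjoint wc wv.
  have := branch_low_card ltw; rewrite lowE => in2.
  apply: leq_ltn_trans in2 _; apply: proper_card; apply/properP; split.
    by apply/subsetP => y /setIP[yw yL]; rewrite in_setD yL (disjointFr dvw).
  by exists c; rewrite ?in_setD ?in_setI ?cL ?andbT branch_center.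
(* Otherwise all vertices outside the branch of v are low; they make up at
   least half of V, hence are at least as many as the branch, which has > j. *)
have -> : L :\: branch v = ~: branch v.
  apply/setP => y; rewrite in_setD in_setC; case: (boolP (y \in branch v)) => //= yv.
  by rewrite inE leqNgt; have := low y; rewrite /= yv /= => ->.
have := cardsC (branch v); have := centroid_branch ctr vc.
by have := branch_card_ge v; lia.
Qed.

Lemma high_card j : #|[set y | j < depth y]| <= #|V|.-1 - j.*2.
Proof.
case: (set_0Vmem [set y | j < depth y]) => [->|[v]]; first by rewrite cards0.
rewrite inE => /low_card; have := cardsC [set y | depth y <= j].
have -> : ~: [set y | depth y <= j] = [set y | j < depth y].
  by apply/setP=> y; rewrite !inE ltnNge.
by lia.
Qed.

Lemma sum_depth_layers :
  \sum_x depth x = \sum_(j < #|V|) #|[set y | j < depth y]|.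
Proof.
under [RHS]eq_bigr => j _ do rewrite -sum1dep_card big_mkcond.
rewrite exchange_big; apply: eq_bigr => x _ /=.
have le := dist_le_card T x c.
by rewrite -big_mkcond -(big_ord_widen _ (fun=> 1) le) sum1_card card_ord.
Qed.

Lemma sum_depth_le : \sum_x depth x <= #|V| ^ 2 %/ 4.
Proof.
rewrite sum_depth_layers -(@sum_truncated_odd _ #|V|); last by lia.
by apply: leq_sum => j _; apply: high_card.
Qed.

(** A sum that attains a termwise upper bound attains it in each term. *)
Lemma sum_depth_max_high j : \sum_x depth x = #|V| ^ 2 %/ 4 ->
  j < #|V| -> #|[set y | j < depth y]| = #|V|.-1 - j.*2.
Proof.
rewrite sum_depth_layers -(@sum_truncated_odd _ #|V|); last by lia.
have tight :=
  leqif_sum (fun (i : 'I_#|V|) (_ : true) => leqif_eq (high_card i)).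
move=> /eqP; rewrite tight => /forallP all_eq ltj.
exact/eqP/(all_eq (Ordinal ltj)).
Qed.

(** Glue the geodesic of a vertex of depth n/2, read backwards, to a geodesic of
    length at least n - 1 - n/2 in a different branch: together with c, these
    account for all vertices. *)
Lemma sum_depth_max_spanning_path : 2 < #|V| -> \sum_x depth x = #|V| ^ 2 %/ 4 ->
  exists x p, [/\ path T x p, uniq (x :: p) & size (x :: p) = #|V|].
Proof.
move=> n3 smax; have high := sum_depth_max_high smax.
have [h def_h] : {h | h = #|V|./2} by exists #|V|./2.
have [m def_m] : {m | m = #|V|.-1 - h} by exists (#|V|.-1 - h).
(* Layer h - 1 has n + 1 - 2h > 0 vertices. *)
have [v vh] : exists v, h <= depth v.
  have : 0 < #|[set y | h.-1 < depth y]| by rewrite high; lia.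
  by case/card_gt0P => v; rewrite inE => vh; exists v; lia.
have vc : v != c by rewrite -(dist_eq0 connT); lia.
have le_branch := centroid_branch ctr vc.
have ge_branch := branch_card_ge v.
(* There are n + 1 - 2m = 2h + 3 - n vertices of depth >= m.  The branch of v has
   at most h vertices, at least m - 1 of which have smaller depth, leaving at
   most h - m + 1 = 2h + 2 - n of depth >= m: one too few. *)
have [w wv wm] : exists2 w, w \notin branch v & m <= depth w.
  have lowv : m.-1 <= #|[set y in branch v | depth y <= m.-1]|.
    by apply: branch_low_card; lia.
  have : 0 < #|[set y | m.-1 < depth y] :\: branch v|.
    have := cardsID (branch v) [set y | m.-1 < depth y].
    rewrite high; last by lia.
    have := cardsID [set y | m.-1 < depth y] (branch v).
    have -> : branch v :\: [set y | m.-1 < depth y]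
            = [set y in branch v | depth y <= m.-1].
      by apply/setP=> y; rewrite !inE -leqNgt andbC.
    by rewrite setIC; lia.
  case/card_gt0P => w; rewrite in_setD inE => /andP[wv wm].
  by exists w => //; lia.
have wc : w != c by rewrite -(dist_eq0 connT); lia.
have dvw := branch_disjoint wc wv.
have [s [Ts ls ds subs]] := geodesic_in_branch v.
have [t [Tt lt dt subt]] := geodesic_in_branch w.
have us := geodesic_uniq ds; have ut := geodesic_uniq dt.
have ss : size s = depth v by rewrite -(size_map (dist T ^~ c)) ds size_iota.
have st : size t = depth w by rewrite -(size_map (dist T ^~ c)) dt size_iota.
have upath : uniq (rev (c :: s) ++ t).
  rewrite cat_uniq rev_uniq us; have /= /andP[ct ->] := ut; rewrite andbT.
  apply/hasPn => y yt; rewrite mem_rev inE negb_or.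
  rewrite (memPn ct) //=; apply/negP => /subs.
  by rewrite (disjointFr dvw) // subt.
have sizep : size (rev (c :: s) ++ t) = #|V|.
  have le : #|V| <= size (rev (c :: s) ++ t).
    rewrite size_cat size_rev /= ss st.
    by move: #|V| def_h def_m => N; lia.
  by apply/eqP; rewrite eqn_leq le andbT -(card_uniqP upath) max_card.
have Tpath : sorted T (rev (c :: s) ++ t).
  rewrite rev_cons cat_rcons sorted_cat_cons Tt andbT -rev_cons rev_sorted /=.
  by rewrite (eq_path (e' := T)) // => y z; rewrite symT.
case def: (rev (c :: s) ++ t) => [|x p]; first by rewrite -sizep def in n3.
by exists x, p; rewrite -def; split=> //; move: Tpath; rewrite def.
Qed.

End Branch.

(** * Path trees *)

Section PathTree.
Variables (V : finType) (T : rel V).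

(** A chord between the positions i and j > i + 1 would close the segment between
    them into a cycle of length at least 3. *)
Lemma tree_path_no_chord x p i j : is_tree T -> path T x p -> uniq (x :: p) ->
  i < j < size (x :: p) -> T (nth x (x :: p) i) (nth x (x :: p) j) -> j = i.+1.
Proof.
move=> treeT Tp up /andP[ltij ltj] Tij.
set s := x :: p in up ltj Tij *.
pose q := take (j - i).+1 (drop i s).
have sq : size q = (j - i).+1 by rewrite size_takel // size_drop; lia.
have nq k : k <= j - i -> nth x q k = nth x s (i + k).
  by move=> lek; rewrite nth_take ?nth_drop.
suff : size q <= 2 by rewrite sq; lia.
apply: (tree_acyclic treeT); rewrite /ucycle take_uniq ?drop_uniq // andbT.
have Tq : sorted T q by apply: take_sorted; apply: drop_sorted.
have n0 := nq 0 (leq0n _); have nl := nq (j - i) (leqnn _).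
case: q sq Tq n0 nl {nq} => [|y q] //= [sq] Tq; rewrite addn0 => n0.
rewrite -sq -last_nth sq subnKC; last exact: ltnW.
by rewrite rcons_path Tq n0 => ->; rewrite (tree_sym treeT).
Qed.

Lemma spanning_path_is_path_tree x p : is_tree T ->
  path T x p -> uniq (x :: p) -> size (x :: p) = #|V| -> is_path_tree T.
Proof.
move=> treeT Tp up sp.
pose f (i : 'I_#|V|) := nth x (x :: p) i.
have injf : injective f.
  by move=> i j /eqP; rewrite nth_uniq ?sp // => /eqP/val_inj.
have ltf (i : 'I_#|V|) : i < size (x :: p) by rewrite sp.
have next (i j : 'I_#|V|) : i.+1 = j -> T (f i) (f j).
  move=> ij; rewrite /f -ij /=; apply: (pathP x Tp).
  by have := ltf j; rewrite /= -ij ltnS.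
exists f; first by apply: inj_card_bij => //; rewrite card_ord.
move=> i j; apply/idP/orP => [Tij|[]/eqP/next//]; last first.
  by rewrite (tree_sym treeT).
case: (ltngtP i j) => [ij|ji|eij].
- by left; rewrite (tree_path_no_chord treeT Tp up _ Tij) // ij ltf.
- rewrite (tree_sym treeT) in Tij.
  by right; rewrite (tree_path_no_chord treeT Tp up _ Tij) // ji ltf.
by move: Tij; rewrite (val_inj eij) (tree_irr treeT).
Qed.

(** The tree distance is bounded below by the difference of positions on the
    path.  To bound the sum of |i - k|, pair i with its mirror n - 1 - i: by the
    triangle inequality |i - k| + |n - 1 - i - k| >= |n - 1 - 2i|. *)
Lemma path_tree_sum_dist_ge c : is_path_tree T -> (forall x y, connect T x y) ->
  #|V| ^ 2 %/ 4 <= \sum_x dist T x c.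
Proof.
move=> [f [g fK gK] Tf] connT.
have stepT x y : T x y -> g x <= (g y).+1 /\ g y <= (g x).+1.
  by rewrite -{1}(gK x) -{1}(gK y) Tf => /orP[]/eqP; lia.
have walkT p x : path T x p ->
    g x <= g (last x p) + size p /\ g (last x p) <= g x + size p.
  elim: p x => [|y p IH] x /=; first by lia.
  case/andP=> /stepT[xy yx] /IH[yl ly].
  split; [apply: leq_trans xy _ | apply: leq_trans ly _]; rewrite addnS.
    by rewrite ltnS.
  by rewrite -addSn leq_add2r.
(* With truncated subtraction, this sum is |i - k|. *)
pose k : nat := g c; pose gap (i : 'I_#|V|) := (i - k) + (k - i).
have gap_le i : gap i <= dist T (f i) c.
  have [p [Tp lp <-]] := dist_attained connT (f i) c.
  by have := walkT p _ Tp; rewrite lp fK /gap /k; lia.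
have -> : \sum_x dist T x c = \sum_i dist T (f i) c.
  by rewrite (reindex f) //; apply: onW_bij; exists g.
apply: leq_trans (leq_sum _ (fun i _ => gap_le i)).
rewrite -(@sum_truncated_odd #|V| #|V|); last by lia.
rewrite -leq_double -!addnn.
rewrite {2}(reindex_inj rev_ord_inj) [X in _ <= _ + X](reindex_inj rev_ord_inj).
rewrite -!big_split; apply: leq_sum => i _ /=.
by rewrite /gap /=; have := ltn_ord i; lia.
Qed.

End PathTree.

Lemma Phi_sum_dist (V : finType) (T : rel V) (c : V) :
  (Phi T c = (\sum_x dist T x c)%N%:Z - #|V|%:Z + 1)%R.
Proof.
rewrite /Phi GRing.sumrB [in RHS](bigD1 c) //= dist0 add0n GRing.sumr_const.
rewrite (big_morph Posz PoszD (erefl (Posz 0))) natz.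
have -> : #|[pred x | x != c]| = #|V|.-1 by exact: cardC1.
have V_gt0 : 0 < #|V| by apply/card_gt0P; exists c.
by move: #|V| (\sum_(i | i != c) (dist T i c)%:Z)%R V_gt0 => N D; lia.
Qed.

Theorem lemma3p16 (n : nat) (hn : 3 <= n) (T : rel 'I_n) (hT : is_tree T)
    (c : 'I_n) (hc : is_centroid T c) :
  (Phi T c <= (n ^ 2 %/ 4)%N%:Z - n%:Z + 1)%R /\
  (Phi T c = ((n ^ 2 %/ 4)%N%:Z - n%:Z + 1)%R <-> is_path_tree T).
Proof.
have [symT _ connT _] := hT.
have le := sum_depth_le symT connT hc.
have max := sum_depth_max_spanning_path symT connT hc.
have ge := path_tree_sum_dist_ge c ^~ connT.
rewrite Phi_sum_dist; rewrite card_ord in le max ge *.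
split; first by lia.
split=> [eqmax|/ge ?]; last by lia.
have [||x [p [Tp up sp]]] := max; [by [] | by lia |].
by apply: (spanning_path_is_path_tree hT Tp up); rewrite card_ord.
Qed.
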